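(* Let $d\ge 1$ and let $A=\{a_{i,j}\}\in\mathbb M_{[0,d]}$ be in the cone $D_{[0,d]}$. Run the following algorithm, where $a_{i,j}$ always denotes the entries of the current matrix $A$. Step 0: Replace $A$ by $A-a_{2,d}E_{2,d}-\sum_{i=0}^d a_{0,i}E_{0,i}$. Set $w=d$. Proceed to Step 1. Step 1: If $w=0$, then proceed to Step 3. Replace $A$ with $A-a_{2,w-1}E_{2,w-1}$. Set $k=1$ and proceed to Step 2. Step 2: If $k=w$, then proceed to Step 3. If $a_{1,w}=0$, then set $w=w-1$ and return to Step 1. Set $$m=\min\Big\{\phi_{w-1-k}(A),\ \frac{\pi_{n,s}(A)}{s-w+k}\ \Big|\ w+1-k\le s\le w,\ 0\le n\le \max\big(0,\min(k-2,\,w-s-1)\big)\Big\}.$$ Replace $A$ with $A-m\,\Gamma_{w-1-k}(k)$. Set $k=k+1$. Repeat Step 2. Step 3: Replace $A$ with $A-\sum_{i=0}^d a_{1,i}E_{1,i}$. Then the algorithm terminates in finitely many steps, $A=0$ at the end of the algorithm, and all appearing coefficients are non-negative; that is, the algorithm reduces $A$ to $0$ by subtracting a finite positive linear combination of matrices from $\Delta\Lambda_2\cap\mathbb M_{[0,d]}$.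
   Context: $\mathbb M$ is the space of matrices $A=\{a_{i,j}\}$, $i\in\{0,1,2\}$, $j\in\mathbb Z$, with finitely many non-zero entries; $\mathbb M_{[0,d]}$ is the subspace of those with $a_{i,j}=0$ for all $i$ whenever $j<0$ or $j>d$. $E_{i,s}\in\mathbb M$ has entry $1$ in position $(i,s)$ and $0$ elsewhere. For $s\in\mathbb Z$, $n\ge 1$, $\Gamma_s(n)\in\mathbb M$ has entries $\gamma_{2,s}=1$, $\gamma_{1,s+1}=\cdots=\gamma_{1,s+n}=-1$, $\gamma_{1,s+n+1}=n$, and all other entries $0$. $\Delta\Lambda_2=\{E_{i,s},\Gamma_s(n)\mid i\in\{0,1,2\},s\in\mathbb Z,n\ge 1\}$. Functionals on $\mathbb M$: $\mu_s(A)=a_{0,s}$, $\tau_s(A)=a_{1,s}+\sum_{i\le s-1}a_{2,i}$, $\phi_s(A)=a_{2,s}$, and for $n\ge 0$, $\pi_{n,s}(A)=\sum_{i>s+n}a_{1,i}+(n+1)a_{1,s+n}+\sum_{i=0}^{n-1}(i+1)a_{2,s+i}$. The set $\mathcal H_{[0,d]}$ consists of: $\mu_s$ for $0\le s\le d$; $\tau_s$ for $0\le s<d$; $\phi_s$ for $0\le s\le d$; $\pi_{0,s}$ for $1\le s\le d$; $\pi_{n,s}$ for $1\le n\le d-2$, $1\le s<d-n$. $D_{[0,d]}=\{A\in\mathbb M_{[0,d]}\mid F(A)\ge 0\text{ for all }F\in\mathcal H_{[0,d]}\}$.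
   Formalization: In Step 2 the test ''a_{1,w}=0'' is made before ''k=w''; in the printed order the claim fails: for d=2, A=Γ_0(1)+E_{2,0} lies in the cone, but the algorithm ends with E_{2,0} instead of 0. *)

(* Defs.v *)
From HB Require Import structures.
From mathcomp Require Import all_boot all_order all_algebra.
From mathcomp Require Import finmap.
From mathcomp.multinomials Require Import monalg.

Set Implicit Arguments.
Unset Strict Implicit.
Unset Printing Implicit Defensive.

Import Order.TTheory GRing.Theory Num.Theory.
Local Open Scope ring_scope.

(* Matrices with 3 rows, columns indexed by int, and finitely many non-zero
   entries. The (i, s) entry of A is A@_(i, s). *)
Notation mat R := {malg R[('I_3 * int)%type]}.

Section Matrices.
Variable R : realFieldType.
Implicit Types (A G : mat R) (n d : nat).

Definition window d A : Prop :=
  forall (i : 'I_3) (j : int), (j < 0) || (d%:Z < j) -> A@_(i, j) = 0.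

Definition E (i : 'I_3) (s : int) : mat R := << (i, s) >>.

Definition Gamma (s : int) n : mat R :=
  E 2 s - \sum_(1 <= j < n.+1) E 1 (s + j%:Z) + n%:R *: E 1 (s + n%:Z + 1).

Definition DeltaLambda2 G : Prop :=
  (exists i s, G = E i s) \/ (exists s n, (1 <= n)%N /\ G = Gamma s n).

Definition mu (s : int) A : R := A@_(0, s).

Definition tau (s : int) A : R :=
  A@_(1, s) + \sum_(p <- msupp A | (p.1 == 2) && (p.2 <= s - 1)) A@_p.

Definition phi (s : int) A : R := A@_(2, s).

Definition pi_ n (s : int) A : R :=
  \sum_(p <- msupp A | (p.1 == 1) && (s + n%:Z < p.2)) A@_p
  + n.+1%:R * A@_(1, s + n%:Z)
  + \sum_(0 <= i < n) i.+1%:R * A@_(2, s + i%:Z).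

Inductive HH d : (mat R -> R) -> Prop :=
| HH_mu (s : int) of 0 <= s <= d%:Z : HH d (mu s)
| HH_tau (s : int) of 0 <= s < d%:Z : HH d (tau s)
| HH_phi (s : int) of 0 <= s <= d%:Z : HH d (phi s)
| HH_pi0 (s : int) of 1 <= s <= d%:Z : HH d (pi_ 0 s)
| HH_pi (n : nat) (s : int) of (1 <= n)%N & n%:Z <= d%:Z - 2 & 1 <= s < d%:Z - n%:Z :
    HH d (pi_ n s).

Definition cone d A : Prop := window d A /\ forall F, HH d F -> 0 <= F A.

Inductive label := Step0 | Step1 | Step2 | Step3 | Halt.

(* cur is the current matrix; out lists, in order, the pairs (c, G) such that
   c *: G has been subtracted so far. *)
Record state := State {
  pc : label; cur : mat R; wvar : nat; kvar : nat; out : seq (R * mat R) }.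

Definition init A : state := State Step0 A 0 0 [::].

Definition subtract (ts : seq (R * mat R)) A : mat R :=
  A - \sum_(t <- ts) t.1 *: t.2.

(* The quotients pi_{n,s}(A) / (s - w + k). The range of s is
   w + 1 - k <= s <= w. Truncated subtraction on nat turns
   max(0, min(k - 2, w - s - 1)) into minn (k - 2) (w - s - 1). *)
Definition quotients (w k : nat) A : seq R :=
  [seq pi_ n s%:Z A / (s%:R - w%:R + k%:R)
     | s <- index_iota (w + 1 - k) w.+1,
       n <- index_iota 0 (minn (k - 2) (w - s - 1)).+1].

Definition mcoef (w k : nat) A : R :=
  \big[Num.min/phi (w%:Z - 1 - k%:Z) A]_(x <- quotients w k A) x.

(* One transition. In Step2 both exit conditions hold when k = w and
   a_{1,w} = 0; then a_{1,w} = 0 takes precedence, which is the only way for w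
   to reach 0 in Step1. With the other precedence the row 2 entries in columns
   < w - 1 may never be cleared: for d = 2, Gamma 0 1 + E 2 0 would be reduced
   to E 2 0 instead of 0. *)
Definition step d (st : state) : state :=
  let: State l A w k o := st in
  match l with
  | Step0 =>
      let ts := (A@_(2, d%:Z), E 2 d%:Z)
                :: [seq (A@_(0, i%:Z), E 0 i%:Z) | i <- iota 0 d.+1] in
      State Step1 (subtract ts A) d k (o ++ ts)
  | Step1 =>
      if w == 0%N then State Step3 A w k o else
      let ts := [:: (A@_(2, w%:Z - 1), E 2 (w%:Z - 1))] in
      State Step2 (subtract ts A) w 1 (o ++ ts)
  | Step2 =>
      if A@_(1, w%:Z) == 0 then State Step1 A w.-1 k o
      else if k == w then State Step3 A w k o
      else
      let ts := [:: (mcoef w k A, Gamma (w%:Z - 1 - k%:Z) k)] in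
      State Step2 (subtract ts A) w k.+1 (o ++ ts)
  | Step3 =>
      let ts := [seq (A@_(1, i%:Z), E 1 i%:Z) | i <- iota 0 d.+1] in
      State Halt (subtract ts A) w k (o ++ ts)
  | Halt => st
  end.

Definition run d A (N : nat) : state := iter N (step d) (init A).

End Matrices.

(* Main.v *)
Require Import Defs.
From mathcomp Require Import all_boot all_order all_algebra.
From mathcomp.multinomials Require Import monalg.
From mathcomp Require Import finmap zify ring lra.
Import Order.TTheory GRing.Theory Num.Theory.
Local Open Scope ring_scope.

(** Write b_j and c_j for the entries of rows 1 and 2. After the initial step
    only these matter, and the algorithm runs through stages (w, k): at stage
    (w, k) row 1 vanishes beyond column w, row 2 vanishes from column w - k on,
    and the matrix satisfies the inequalities tau_s and pi_{n,s} of the cone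
    attached to the window [0,w] (predicate [stage]).

    The matrix Gamma_{w-1-k}(k) subtracted at stage (w, k) is chosen so that
    all tau_s with s < w vanish on it, while pi_{n,s} takes the value
    max(0, s - w + k) ([tau_Gamma], [pi_Gamma]). Hence the coefficient m of
    the algorithm, a minimum over c_{w-1-k} and the quotients of all pi_{n,s}
    with s > w - k, is the largest multiple whose subtraction stays in the
    cone ([stage_subtract_Gamma]).

    It must be shown that this subtraction makes progress, i.e. that either
    b_w or c_{w-1-k} becomes 0. Put B_t = b_t + ... + b_w. Row 2 is zero from
    column w - k on, so pi_{n,s} = (n+1) B_t - n B_{t+1} with t = s + n when
    s >= w - k. The inequalities with s = w - k say that B_t / (t - (w - k)) is
    nonincreasing in t for w - k < t <= w. So b_w > 0 forces B_t > 0 for these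
    t, and then every pi_{n,s} of the cone with s > w - k is strictly positive
    ([pi_gt0]). Applied to the matrix obtained by the subtraction, this shows
    that if b_w is still nonzero then no pi_{n,s} occurring in m has become 0,
    so the minimum was attained at c_{w-1-k}, which is now 0 ([mcoef_tight]).

    Consequently Step 2 leads from stage (w, k) to stage (w, k + 1) or, once
    b_w = 0, back to Step 1 at stage (w - 1, 0). When k = w, in particular when
    w = 0, row 2 is zero and tau_s = b_s, so Step 3 removes a nonnegative
    combination of the E_{1,s} ([decomposes_step3]). *)

(** * The functionals as sums over columns *)

Lemma msupp_row {R : realFieldType} (w : nat) (A : mat R) (i : 'I_3)
    (Q : pred int) :
  window w A ->
  \sum_(p <- msupp A | (p.1 == i) && Q p.2) A@_p
    = \sum_(0 <= j < w.+1 | Q j%:Z) A@_(i, j%:Z).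
Proof.
move=> Aw; pose f (j : nat) := (i, j%:Z).
rewrite -(big_map f (fun p => Q p.2) (fun p => A@_p)).
rewrite [RHS](bigID (fun p => p \in msupp A)) /=.
rewrite [X in _ = _ + X]big1 ?addr0; last first.
  by move=> p /andP[_ /mcoeff_outdom].
rewrite -big_filter -[RHS]big_filter; apply: perm_big; apply: uniq_perm.
- exact/filter_uniq/fset_uniq.
- have finj : injective f by move=> a b [].
  apply: filter_uniq.
  by have := map_inj_uniq finj (index_iota 0 w.+1); rewrite iota_uniq.
have mem_f (p : 'I_3 * int) :
    (p \in [seq f j | j <- index_iota 0 w.+1]) = (p.1 == i) && (0 <= p.2 <= w%:Z).
  case: p => i' j; apply/mapP/andP => /= [[a]|[/eqP -> ij]].
    by rewrite mem_index_iota => aw [-> ->]; split; [|lia].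
  by exists `|j|%N; [rewrite mem_index_iota; lia | congr pair; lia].
case=> i' j; rewrite !mem_filter /=.
set b := (X in _ = _ && X); have -> : b = _ := mem_f _.
case: (boolP ((i', j) \in msupp A)); last by rewrite !(andbF, andFb).
rewrite -mcoeff_neq0 /= => nz; rewrite !andbT.
have -> : 0 <= j <= w%:Z; last by rewrite andbT andbC.
apply: contraNT nz => j_out; apply/eqP/Aw; lia.
Qed.

Lemma mcoeff_E {R : realFieldType} i s (i' : 'I_3) (s' : int) :
  (E R i s)@_(i', s') = ((i == i') && (s == s'))%:R.
Proof. by rewrite /E mcoeffU xpair_eqE. Qed.

Definition row1_tail {R : realFieldType} (w t : nat) (A : mat R) : R :=
  \sum_(t <= j < w.+1) A@_(1, j%:Z).

Section Algorithm.
Context {R : realFieldType}.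
Implicit Types (A G : mat R) (w k n s : nat).

Lemma row1_tail_recl w t A : (t <= w)%N ->
  row1_tail w t A = A@_(1, t%:Z) + row1_tail w t.+1 A.
Proof. by move=> tw; rewrite /row1_tail big_ltn. Qed.

Lemma tauE w s A : window w A -> (s <= w)%N ->
  tau s%:Z A = A@_(1, s%:Z) + \sum_(0 <= j < s) A@_(2, j%:Z).
Proof.
move=> Aw sw; rewrite /tau (msupp_row w A 2 (fun j => j <= s%:Z - 1)) //.
congr (_ + _); rewrite [RHS](big_nat_widen _ _ w.+1) ?leqW //.
by apply: eq_bigl => j; lia.
Qed.

(** Writing pi_{n,s} through the tails of row 1 makes visible the comparison of
    two consecutive tails on which the proof rests. *)
Lemma piE w n s A : window w A -> (s + n <= w)%N ->
  pi_ n s%:Z A = n.+1%:R * row1_tail w (s + n) A - n%:R * row1_tail w (s + n).+1 A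
                 + \sum_(0 <= i < n) i.+1%:R * A@_(2, (s + i)%N%:Z).
Proof.
move=> Aw sw; rewrite /pi_ (msupp_row w A 1 (fun j => s%:Z + n%:Z < j)) //.
have -> : \sum_(0 <= j < w.+1 | s%:Z + n%:Z < j%:Z) A@_(1, j%:Z)
        = row1_tail w (s + n).+1 A.
  by rewrite /row1_tail [RHS](big_nat_widenl _ 0) //; apply: eq_bigl => j; lia.
by rewrite (row1_tail_recl _ (s + n)) // PoszD; congr (_ + _); ring.
Qed.

Lemma windowB d A G c : window d A -> window d G -> window d (A - c *: G).
Proof.
by move=> Aw Gw i j ij; rewrite mcoeffB mcoeffZ Aw // Gw // mulr0 subr0.
Qed.

Lemma tauB w s A G (c : R) : window w A -> window w G -> (s <= w)%N ->
  tau s%:Z (A - c *: G) = tau s%:Z A - c * tau s%:Z G.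
Proof.
move=> Aw Gw sw; rewrite !(tauE w) //; last exact: windowB.
rewrite (eq_bigr (fun j => A@_(2, j%:Z) - c * G@_(2, j%:Z))).
  by rewrite sumrB -mulr_sumr mcoeffB mcoeffZ; ring.
by move=> j _; rewrite mcoeffB mcoeffZ.
Qed.

Lemma piB w n s A G c : window w A -> window w G -> (s + n <= w)%N ->
  pi_ n s%:Z (A - c *: G) = pi_ n s%:Z A - c * pi_ n s%:Z G.
Proof.
move=> Aw Gw sw; rewrite !(piE w) //; last exact: windowB.
have sumB (a b : nat) i :
    \sum_(a <= j < b) (A - c *: G)@_(i, j%:Z)
      = \sum_(a <= j < b) A@_(i, j%:Z) - c * \sum_(a <= j < b) G@_(i, j%:Z).
  by rewrite mulr_sumr -sumrB; apply: eq_bigr => j _; rewrite mcoeffB mcoeffZ.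
rewrite /row1_tail !sumB.
rewrite [X in _ + X = _](eq_bigr (fun i =>
    i.+1%:R * A@_(2, (s + i)%N%:Z) - c * (i.+1%:R * G@_(2, (s + i)%N%:Z)))).
  rewrite sumrB -mulr_sumr; ring.
by move=> i _; rewrite mcoeffB mcoeffZ; ring.
Qed.

(** * The matrices Gamma *)

Lemma mcoeff_Gamma s n i (j : int) : (Gamma R s%:Z n)@_(i, j) =
  ((2 == i) && (s%:Z == j))%:R
  - \sum_(1 <= m < n.+1) ((1 == i) && (s%:Z + m%:Z == j))%:R
  + n%:R * ((1 == i) && (s%:Z + n%:Z + 1 == j))%:R.
Proof.
rewrite /Gamma; set S := \sum_(_ <= _ < _) _; set X := E R 1 _.
rewrite mcoeffD mcoeffB mcoeffZ; congr (_ - _ + _ * _); try exact: mcoeff_E.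
rewrite (raddf_sum (mcoeff (i, j))).
by apply: eq_bigr => m _; exact: mcoeff_E.
Qed.

Lemma Gamma_row0 s n (j : int) : (Gamma R s%:Z n)@_(0, j) = 0.
Proof.
by rewrite mcoeff_Gamma /= big1 ?mulr0 ?subr0 ?addr0.
Qed.

Lemma Gamma_row2 s n (j : int) : (Gamma R s%:Z n)@_(2, j) = (s%:Z == j)%:R.
Proof.
by rewrite mcoeff_Gamma /= big1 ?mulr0 ?subr0 ?addr0.
Qed.

Lemma Gamma_row1 s n t : (Gamma R s%:Z n)@_(1, t%:Z) =
  n%:R * (t == s + n.+1)%N%:R - (s < t <= s + n)%N%:R.
Proof.
rewrite mcoeff_Gamma /= sub0r addrC; congr (_ * _%:R - _); first by lia.
have [h|h] := boolP (s < t <= s + n)%N.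
  rewrite (bigD1_seq (t - s)%N) ?mem_index_iota ?iota_uniq //=; last lia.
  rewrite big1 => [|i hi]; first by rewrite addr0; congr (_%:R); lia.
  by rewrite (_ : (_ == _) = false) //; lia.
rewrite big_nat big1 // => i hi.
by rewrite (_ : (_ == _) = false) //; lia.
Qed.

Lemma Gamma_window s n : window (s + n.+1) (Gamma R s%:Z n).
Proof.
move=> i j ij; rewrite mcoeff_Gamma big_nat big1 => [|m hm]; last first.
  by rewrite (_ : _ == j = false) ?andbF //; lia.
rewrite (_ : s%:Z == j = false); last by lia.
by rewrite (_ : _ + 1 == j = false) ?andbF ?mulr0 ?addr0 ?subr0 //; lia.
Qed.

(** The tails telescope: the entry of row 1 in column j is the difference at
    j and j + 1 of the truncated subtraction j - (s + 1), cut off to 0 after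
    the last column. *)
Lemma row1_tail_Gamma s n t : (t <= s + n.+1)%N ->
  row1_tail (s + n.+1) t (Gamma R s%:Z n) = (t - s.+1)%:R.
Proof.
move=> ts; pose g j : R := if (j <= s + n.+1)%N then (j - s.+1)%:R else 0.
rewrite /row1_tail (eq_big_nat _ _ (F2 := fun j => - (g j.+1 - g j))).
  rewrite sumrN telescope_sumr; last by lia.
  by rewrite /g ts ltnn sub0r opprK.
move=> j hj; rewrite Gamma_row1 /g.
rewrite (_ : (j <= s + n.+1)%N = true); last by lia.
have [e|ne] := eqVneq j (s + n.+1)%N.
  rewrite e ltnn (_ : (_ <= s + n)%N = false) ?andbF; last by lia.
  by rewrite (_ : (_ - s.+1)%N = n); [rewrite /=; ring|lia].
rewrite (_ : (j < s + n.+1)%N = true); last by lia.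
case: (ltnP s j) => sj.
  rewrite (_ : (j <= s + n)%N = true); last by lia.
  rewrite subSS /= (_ : (j - s = (j - s.+1).+1)%N); last by lia.
  by rewrite -natr1; ring.
by rewrite (_ : (j - s.+1 = 0)%N) 1?(_ : (j.+1 - s.+1 = 0)%N) /=; [ring|lia|lia].
Qed.

(** The subtraction on the right is truncated: the value is 0 for s' <= s + 1.
    When s' <= s < s' + n' the tails of row 1 contribute -(s - s' + 1), and
    s - s' + 1 is the weight of the entry 1 of row 2. *)
Lemma pi_Gamma s n (s' n' : nat) : 
  (s' + n' <= s + n)%N || ((s' == s + n.+1)%N && (n' == 0)%N) ->
  pi_ n' s'%:Z (Gamma R s%:Z n) = (s' - s.+1)%:R.
Proof.
move=> h; rewrite (piE (s + n.+1)); [|exact: Gamma_window|lia].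
case/orP: h => [h|/andP[/eqP -> /eqP ->]]; last first.
  by rewrite addn0 row1_tail_Gamma ?leqnn // big_geq //; ring.
rewrite !row1_tail_Gamma; [|lia|lia].
have [lt|ge] := ltnP s s'.
  rewrite big1 => [|i _]; last first.
    by rewrite Gamma_row2 (_ : _ == _ = false) ?mulr0 //; lia.
  rewrite (_ : (s' + n' - s.+1 = s' - s.+1 + n')%N); last by lia.
  rewrite (_ : ((s' + n').+1 - s.+1 = s' - s.+1 + n'.+1)%N); last by lia.
  by rewrite !natrD -natr1; ring.
rewrite [RHS](_ : _ = 0); last by rewrite (_ : (s' - s.+1 = 0)%N) //; lia.
have [lt|ge'] := ltnP s (s' + n').
  rewrite (bigD1_seq (s - s')%N) ?mem_index_iota ?iota_uniq //=; last lia.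
  rewrite big1 => [|i hi]; last first.
    by rewrite Gamma_row2 (_ : _ == _ = false) ?mulr0 //; lia.
  rewrite Gamma_row2 (_ : (_ == _) = true); last by lia.
  set x := (s - s')%N; set y := (s' + n' - s.+1)%N.
  rewrite (_ : ((s' + n').+1 - s.+1 = y.+1)%N); last by lia.
  by rewrite (_ : n' = (x + y.+1)%N); [rewrite -!natr1 !natrD -!natr1; ring|lia].
rewrite big_nat big1 => [|i hi]; last first.
  by rewrite Gamma_row2 (_ : _ == _ = false) ?mulr0 //; lia.
rewrite (_ : (s' + n' - s.+1 = 0)%N); last by lia.
by rewrite (_ : ((s' + n').+1 - s.+1 = 0)%N); [ring|lia].
Qed.

Lemma tau_Gamma s n t : (t <= s + n)%N -> tau t%:Z (Gamma R s%:Z n) = 0.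
Proof.
move=> ts; rewrite (tauE (s + n.+1)); [|exact: Gamma_window|lia].
rewrite Gamma_row1.
rewrite (_ : (t == _) = false); last by lia.
rewrite ts andbT; case: ltnP => st.
  rewrite (bigD1_seq s) ?mem_index_iota ?iota_uniq //=.
  rewrite big1 => [|i hi]; rewrite Gamma_row2 ?eqxx; first by rewrite /=; ring.
  by rewrite (_ : _ == _ = false) //; lia.
rewrite big_nat big1 => [|i hi]; first by rewrite /=; ring.
by rewrite Gamma_row2 (_ : _ == _ = false) //; lia.
Qed.

(** * The invariant of a stage *)

Lemma window_le (w d : nat) A : (w <= d)%N -> window w A -> window d A.
Proof. by move=> wd Aw i j ij; apply: Aw; lia. Qed.

Lemma row1_tail_last w A : row1_tail w w A = A@_(1, w%:Z).
Proof. by rewrite /row1_tail big_nat1. Qed.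

Lemma pi_last w A : window w A -> pi_ 0 w%:Z A = A@_(1, w%:Z).
Proof.
move=> Aw; rewrite (piE w) ?addn0 // row1_tail_last big_geq //; ring.
Qed.

(** The indices of the functionals pi_{n,s} in the set H attached to [0,w]; the
    pairs (0, s) with s < w are covered by the first disjunct. *)
Definition pi_range w n s : bool :=
  (0 < s)%N && ((s + n < w)%N || ((s == w) && (n == 0)%N)).

(** The range of tau includes s = w, which the set H attached to [0,w] omits:
    for w > 0 this inequality follows from pi_{0,w} >= 0 ([tau_last_ge0]), and
    for w = 0 it makes the remaining entry of row 1 nonnegative. *)
Record stage w k A : Prop := {
  stage_window : window w A;
  stage_row0 : forall j : int, A@_(0, j) = 0;
  stage_row2_ge0 : forall j : nat, 0 <= A@_(2, j%:Z);
  stage_row2_eq0 : forall j : nat, (w - k <= j)%N -> A@_(2, j%:Z) = 0;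
  stage_tau : forall s : nat, (s <= w)%N -> 0 <= tau s%:Z A;
  stage_pi : forall n s : nat, pi_range w n s -> 0 <= pi_ n s%:Z A }.

Lemma tau_last_ge0 w A : window w A -> (0 < w)%N ->
  (forall j : nat, 0 <= A@_(2, j%:Z)) -> 0 <= pi_ 0 w%:Z A -> 0 <= tau w%:Z A.
Proof.
move=> Aw w0 A2; rewrite pi_last // (tauE w) // => b0.
by apply: addr_ge0 => //; apply: sumr_ge0.
Qed.

(** Step 1 (k = 1) and the initial step (k = 0) clear row 2 from column w - k
    on. This is harmless: tau_s with s < w involves row 2 only before column s,
    and pi_{n,s} with n > 0 only before column s + n < w. *)
Lemma stage_clear w k A A' : (0 < w)%N -> (k <= 1)%N ->
  window w A -> window w A' ->
  (forall j : int, A'@_(0, j) = 0) ->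
  (forall j : int, A'@_(1, j) = A@_(1, j)) ->
  (forall j : nat, A'@_(2, j%:Z) = if (j < w - k)%N then A@_(2, j%:Z) else 0) ->
  (forall j : nat, 0 <= A@_(2, j%:Z)) ->
  (forall s : nat, (s < w)%N -> 0 <= tau s%:Z A) ->
  (forall n s : nat, pi_range w n s -> 0 <= pi_ n s%:Z A) ->
  stage w k A'.
Proof.
move=> w0 k1 Aw A'w row0 row1 row2 phi_ge0 tau_ge0 pi_ge0.
have row2_ge0 (j : nat) : 0 <= A'@_(2, j%:Z) by rewrite row2; case: ifP.
have pi'E (n s : nat) : pi_range w n s -> pi_ n s%:Z A' = pi_ n s%:Z A.
  move=> nsw; have snw : (s + n <= w)%N by move: nsw; rewrite /pi_range; lia.
  have row1_tail' t : row1_tail w t A' = row1_tail w t A by apply: eq_bigr.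
  rewrite !(piE w) // !row1_tail'; congr (_ + _).
  apply: eq_big_nat => i i_n; congr (_ * _).
  by rewrite row2 ifT //; move: nsw; rewrite /pi_range; lia.
split=> //.
- by move=> j jw; rewrite row2 ifF //; lia.
- move=> s; rewrite leq_eqVlt => /predU1P[->|sw].
    apply: tau_last_ge0 => //; rewrite pi'E ?pi_ge0 //.
      by rewrite /pi_range w0 !eqxx orbT.
    by rewrite /pi_range w0 !eqxx orbT.
  have := tau_ge0 s sw; rewrite !(tauE w) ?(ltnW sw) // row1.
  rewrite (@eq_big_nat _ _ _ _ _ _ (fun j => A'@_(2, j%:Z))) // => j js.
  by rewrite row2 ifT //; lia.
- by move=> n s nsw; rewrite pi'E ?pi_ge0.
Qed.

Lemma ord3_case (i : 'I_3) : [\/ i = 0, i = 1 | i = 2].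
Proof.
by case: i => [[|[|[|//]]]] i3;
  [constructor 1|constructor 2|constructor 3]; apply: val_inj.
Qed.

(** Passing from w + 1 to w only discards inequalities, and k > 0 already makes
    row 2 zero from column w on. *)
Lemma stage_shrink w k A : stage w.+1 k A -> (0 < k)%N -> A@_(1, w.+1%:Z) = 0 ->
  stage w 0 A.
Proof.
move=> [Aw row0 row2_ge0 row2_eq0 tau_ge0 pi_ge0] k0 b0; split=> //.
- move=> i j ij; have [|jw] := boolP ((j < 0) || (w.+1%:Z < j)).
    exact: Aw.
  have -> : j = w.+1%:Z by lia.
  by case: (ord3_case i) => ->; rewrite ?row2_eq0 //; lia.
- by move=> j jw; rewrite row2_eq0 //; lia.
- by move=> s sw; apply: tau_ge0; lia.
- by move=> n s nsw; apply: pi_ge0; move: nsw; rewrite /pi_range; lia.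
Qed.

(** * The coefficient of Gamma *)

(** On columns t > w - k the quotient of the tail B_t by t - (w - k) does not
    increase with t, so all these tails inherit positivity from the last one,
    b_w; and for s > w - k the functional pi_{n,s} compares B_t and B_{t+1}
    with a weaker slope than the one available. *)
Lemma pi_gt0 w k A : stage w k A -> (0 < k < w)%N -> A@_(1, w%:Z) != 0 ->
  forall n s, (w - k < s)%N -> pi_range w n s -> 0 < pi_ n s%:Z A.
Proof.
move=> [Aw row0 row2_ge0 row2_eq0 tau_ge0 pi_ge0] /andP[k0 kw] bw0.
have piT n s : (w - k <= s)%N -> (s + n <= w)%N ->
    pi_ n s%:Z A
      = n.+1%:R * row1_tail w (s + n) A - n%:R * row1_tail w (s + n).+1 A.
  move=> ks snw; rewrite (piE w) // big_nat big1 ?addr0 // => i _.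
  by rewrite row2_eq0 ?mulr0 //; lia.
(* The inequality pi_{n,s} >= 0 at s = w - k, n = t - (w - k). *)
have slope t : (w - k < t)%N -> (t < w)%N ->
    (t - (w - k))%:R * row1_tail w t.+1 A
      <= (t - (w - k)).+1%:R * row1_tail w t A.
  move=> kt tw; rewrite -subr_ge0.
  have := pi_ge0 (t - (w - k))%N (w - k)%N; rewrite piT ?subnKC //; try lia.
  by apply; rewrite /pi_range; lia.
have bw_gt0 : 0 < A@_(1, w%:Z).
  rewrite lt_def bw0 -pi_last // pi_ge0 // /pi_range; lia.
have tail_gt0 e : (e < k)%N -> 0 < row1_tail w (w - e) A.
  elim: e => [|e IHe] ek; first by rewrite subn0 row1_tail_last.
  have := slope (w - e.+1)%N; rewrite (_ : (w - e.+1).+1 = w - e)%N; last by lia.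
  move=> /(_ _ _)/(lt_le_trans _) h.
  suff : 0 < (w - e.+1 - (w - k)).+1%:R * row1_tail w (w - e.+1) A.
    by rewrite pmulr_rgt0.
  by apply: h; rewrite ?pmulr_rgt0 ?IHe ?ltr0n //; lia.
move=> n s ks /andP[s0 /orP[snw|/andP[/eqP -> /eqP ->]]]; last by rewrite pi_last.
rewrite piT; [|lia|lia].
have next_gt0 : 0 < row1_tail w (s + n).+1 A.
  by have := tail_gt0 (w - (s + n).+1)%N; rewrite subKn //; apply; lia.
have := slope (s + n)%N; move=> /(_ ltac:(lia) snw).
move: (row1_tail w (s + n).+1 A) next_gt0 (row1_tail w (s + n) A) => U U0 T.
have en : (n < s + n - (w - k))%N by lia.
move: (s + n - (w - k))%N en => e en slo.
(* With e = s + n - (w - k) > n: multiplying by e + 1 bounds the value below by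
   (e - n) U, where U is the tail from column s + n + 1 on. *)
have e0 : 0 < e.+1%:R :> R by rewrite ltr0n.
rewrite -(pmulr_rgt0 _ e0).
have : n.+1%:R * (e%:R * U) <= n.+1%:R * (e.+1%:R * T).
  by apply: ler_wpM2l slo; rewrite ler0n.
have : 0 < (e - n)%:R * U by apply: mulr_gt0; rewrite ?ltr0n ?subn_gt0.
by rewrite natrB ?(ltnW en) // -!natr1; nra.
Qed.

Lemma bigmin_mem (x : R) (r : seq R) :
  \big[Num.min/x]_(y <- r) y \in x :: r.
Proof.
elim: r => [|y r IHr]; first by rewrite big_nil mem_head.
rewrite big_cons; case: leP => _; first by rewrite !inE eqxx orbT.
by move: IHr; rewrite !inE => /orP[->|->]; rewrite ?orbT.
Qed.

Lemma bigmin_le_mem (x : R) (r : seq R) y :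
  y \in x :: r -> \big[Num.min/x]_(z <- r) z <= y.
Proof.
elim: r => [|z r IHr]; first by rewrite big_nil inE => /eqP ->.
rewrite big_cons !inE orbCA => /predU1P[->|yr]; first by rewrite ge_min lexx.
by rewrite ge_min IHr ?orbT // inE.
Qed.

(** For w - k < s < w the bound w - s - 1 on n is at most k - 2, so the quotients
    come exactly from the pi_{n,s} in the set H attached to [0,w] that are
    positive on Gamma_{w-1-k}(k). *)
Lemma mem_quotients w k A x : (0 < k < w)%N ->
  x \in quotients w k A <->
  exists n s : nat, [/\ (w - k < s)%N, pi_range w n s
                & x = pi_ n s%:Z A / (s - (w - k))%:R].
Proof.
move=> /andP[k0 kw].
have denE s : (w - k < s)%N -> s%:R - w%:R + k%:R = (s - (w - k))%:R :> R.
  by move=> ks; rewrite !natrB ?(ltnW kw) ?(ltnW ks) //; ring.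
split.
  case/allpairsPdep => s [n] [].
  rewrite !mem_index_iota => hs hn ->; exists n, s; split; first by lia.
    by rewrite /pi_range; lia.
  by rewrite denE //; lia.
case=> n [s [ks nsw ->]]; rewrite -denE //.
apply/allpairsPdep; exists s, n; split=> //=; rewrite mem_index_iota.
  by move: nsw; rewrite /pi_range; lia.
by move: nsw; rewrite /pi_range; lia.
Qed.

Lemma mcoef_ge0 w k A : stage w k A -> (0 < k < w)%N -> 0 <= mcoef w k A.
Proof.
move=> [Aw row0 row2_ge0 row2_eq0 tau_ge0 pi_ge0] kw; have /andP[k0 k_lt_w] := kw.
have := bigmin_mem (phi (w%:Z - 1 - k%:Z) A) (quotients w k A).
rewrite inE => /predU1P[|/(mem_quotients _ _ _ _ kw)]; rewrite /mcoef.
  move=> ->; rewrite /phi (_ : w%:Z - 1 - k%:Z = (w - k.+1)%N%:Z) //; lia.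
by move=> [n [s [_ nsw ->]]]; rewrite divr_ge0 ?pi_ge0.
Qed.

Lemma mcoef_le_phi w k A : mcoef w k A <= phi (w%:Z - 1 - k%:Z) A.
Proof. by apply: bigmin_le_mem; rewrite mem_head. Qed.

Lemma mcoef_le_pi w k A n s : (0 < k < w)%N -> (w - k < s)%N ->
  pi_range w n s -> mcoef w k A * (s - (w - k))%:R <= pi_ n s%:Z A.
Proof.
move=> kw ks nsw; rewrite -ler_pdivlMr ?ltr0n ?subn_gt0 //.
apply: bigmin_le_mem; rewrite inE; apply/orP; right.
by apply/mem_quotients => //; exists n, s.
Qed.

(** The functionals that vanish on Gamma keep their values; the others are
    those over which the minimum is taken. The remaining tau_w is recovered
    from b_w = pi_{0,w} >= 0. *)
Lemma stage_subtract_Gamma w k A : stage w k A -> (0 < k < w)%N ->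
  stage w k (A - mcoef w k A *: Gamma R (w - k.+1)%N%:Z k).
Proof.
move=> inv kw; have m0 := mcoef_ge0 w k A inv kw; have mphi := mcoef_le_phi w k A.
have mpi n s := @mcoef_le_pi w k A n s kw.
move: inv => [Aw row0 row2_ge0 row2_eq0 tau_ge0 pi_ge0].
move: (mcoef w k A) m0 mphi mpi => m m0 mphi mpi; move/andP: kw => [k0 kw].
set G := Gamma R _ _.
have Gw : window w G.
  by have := Gamma_window (w - k.+1) k; rewrite subnK.
have A'w := windowB w A G m Aw Gw.
have row2' (j : nat) : 0 <= (A - m *: G)@_(2, j%:Z).
  rewrite mcoeffB mcoeffZ Gamma_row2.
  have [e|ne] := eqVneq (w - k.+1)%N j; last first.
    by rewrite (_ : (_ == _) = false) ?mulr0 ?subr0 //; apply/negbTE.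
  rewrite -e eqxx mulr1 subr_ge0; apply: le_trans mphi _.
  by rewrite /phi (_ : w%:Z - 1 - k%:Z = (w - k.+1)%N%:Z) //; lia.
have pi' n s : pi_range w n s -> 0 <= pi_ n s%:Z (A - m *: G).
  move=> nsw; rewrite (piB w) //; last by move: nsw; rewrite /pi_range; lia.
  rewrite pi_Gamma; last by move: nsw; rewrite /pi_range; lia.
  have [ks|sk] := ltnP (w - k) s.
    by rewrite subr_ge0 (_ : (s - _ = s - (w - k))%N) ?mpi //; lia.
  by rewrite (_ : (s - _ = 0)%N) ?mulr0 ?subr0 ?pi_ge0 //; lia.
split=> //.
- by move=> j; rewrite mcoeffB mcoeffZ row0 Gamma_row0 mulr0 subr0.
- move=> j jw; rewrite mcoeffB mcoeffZ row2_eq0 // Gamma_row2.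
  by rewrite (_ : (_ == _) = false) ?mulr0 ?subr0 //; lia.
- move=> s; rewrite leq_eqVlt => /predU1P[->|sw].
    apply: tau_last_ge0 => //; first lia.
    by apply: pi'; rewrite /pi_range; lia.
  rewrite (tauB w) ?(ltnW sw) // tau_Gamma; last by lia.
  by rewrite mulr0 subr0 tau_ge0 // ltnW.
Qed.

(** If the minimum were attained at a quotient of pi_{n,s}, that functional would
    vanish after the subtraction, contradicting [pi_gt0] applied to the new
    matrix. So the minimum is c_{w-1-k}, and the new entry there is 0. *)
Lemma mcoef_tight w k A : stage w k A -> (0 < k < w)%N ->
  let A' := A - mcoef w k A *: Gamma R (w - k.+1)%N%:Z k in
  A'@_(1, w%:Z) != 0 -> stage w k.+1 A'.
Proof.
move=> inv kw A' bw.
have inv' : stage w k A' := stage_subtract_Gamma w k A inv kw.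
have kk : w%:Z - 1 - k%:Z = (w - k.+1)%N%:Z by lia.
suff m_phi : mcoef w k A = phi (w%:Z - 1 - k%:Z) A.
  case: (inv') => Aw row0 row2_ge0 row2_eq0 tau_ge0 pi_ge0; split=> // j jw.
  have [e|ne] := eqVneq (w - k.+1)%N j; last by apply: row2_eq0; lia.
  by rewrite /A' -e mcoeffB mcoeffZ Gamma_row2 eqxx m_phi kk mulr1 subrr.
have := bigmin_mem (phi (w%:Z - 1 - k%:Z) A) (quotients w k A).
rewrite -/(mcoef w k A) inE => /predU1P[//|/(mem_quotients _ _ _ _ kw)].
move=> [n [s [ks nsw m_pi]]]; have := pi_gt0 w k A' inv' kw bw n s ks nsw.
rewrite (piB w); first last.
- by move: nsw; rewrite /pi_range; lia.
- have := Gamma_window (w - k.+1) k; rewrite subnK //; lia.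
- by case: inv.
rewrite pi_Gamma; last by move: nsw; rewrite /pi_range; lia.
rewrite (_ : (s - _ = s - (w - k))%N); last by lia.
by rewrite m_pi divfK ?subrr ?ltxx // pnatr_eq0 -lt0n subn_gt0.
Qed.

(** * Running the algorithm *)

Definition sum_terms (ts : seq (R * mat R)) : mat R := \sum_(t <- ts) t.1 *: t.2.

Definition good_term d (t : R * mat R) : Prop :=
  [/\ 0 <= t.1, DeltaLambda2 t.2 & window d t.2].

(** Stated for an arbitrary intermediate state, hence relative to the terms
    already output: only the terms [ts] still to come must sum to the current
    matrix. *)
Definition decomposes d (st : state R) : Prop :=
  exists N ts, let st' := iter N (step d) st in
    [/\ pc st' = Halt, cur st' = 0, out st' = out st ++ ts,
        forall t, t \in ts -> good_term d t & cur st = sum_terms ts].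

Lemma decomposes_step d st ts :
  out (step d st) = out st ++ ts -> cur (step d st) = cur st - sum_terms ts ->
  (forall t, t \in ts -> good_term d t) ->
  decomposes d (step d st) -> decomposes d st.
Proof.
move=> out_step cur_step good_ts [N [us [haltN curN outN good_us cur_us]]].
exists N.+1, (ts ++ us); rewrite iterSr; split=> //.
- by rewrite outN out_step catA.
- by move=> t; rewrite mem_cat => /orP[/good_ts|/good_us].
by rewrite /sum_terms big_cat /= -/(sum_terms us) -cur_us cur_step addrC subrK.
Qed.

Lemma decomposes_silent d st :
  out (step d st) = out st -> cur (step d st) = cur st ->
  decomposes d (step d st) -> decomposes d st.
Proof.
move=> out_step cur_step; apply: (decomposes_step d st [::]); rewrite ?cats0 //.
by rewrite /sum_terms big_nil subr0.
Qed.

Definition row_terms d i A : seq (R * mat R) :=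
  [seq (A@_(i, j%:Z), E R i j%:Z) | j <- iota 0 d.+1].

Lemma sum_row_terms d i A i' (j : int) : window d A ->
  (sum_terms (row_terms d i A))@_(i', j) = (i == i')%:R * A@_(i', j).
Proof.
move=> Aw; rewrite /sum_terms big_map raddf_sum.
move: (iota _ _) (mem_iota 0 d.+1) (iota_uniq 0 d.+1) => r mem_r uniq_r /=.
have [<-|ne] := eqVneq i i'; last first.
  rewrite mul0r big1 // => m _.
  by rewrite mcoeffZ mcoeff_E (negbTE ne) mulr0.
rewrite mul1r; have [jd|jd] := boolP ((j < 0) || (d%:Z < j)).
  rewrite (Aw i) // big1_seq // => m /andP[_]; rewrite mem_r => md.
  by rewrite mcoeffZ mcoeff_E (_ : (_ == j) = false) ?andbF ?mulr0 //; lia.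
rewrite (bigD1_seq `|j|%N) ?mem_r //=; last lia.
rewrite big1 => [|m hm].
  rewrite mcoeffZ mcoeff_E eqxx (_ : Posz `|j| = j); last by lia.
  by rewrite eqxx mulr1 addr0.
by rewrite mcoeffZ mcoeff_E (_ : (_ == j) = false) ?andbF ?mulr0 //; lia.
Qed.

Lemma window_E d i (s : int) : 0 <= s <= d%:Z -> window d (E R i s).
Proof.
by move=> sd i' j jd; rewrite mcoeff_E (_ : (s == j) = false) ?andbF //; lia.
Qed.

Lemma good_E d c i (s : int) : 0 <= s <= d%:Z -> 0 <= c ->
  good_term d (c, E R i s).
Proof. by move=> sd c0; split=> //=; [left; exists i, s | exact: window_E]. Qed.

Lemma good_row_terms d i A : (forall j : nat, (j <= d)%N -> 0 <= A@_(i, j%:Z)) ->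
  forall t, t \in row_terms d i A -> good_term d t.
Proof.
move=> A0 t /mapP[j]; rewrite mem_iota => jd ->.
by apply: good_E; [lia | apply: A0; lia].
Qed.

(** At stage (w, w) row 2 is zero, so tau_s is the entry of row 1. *)
Lemma decomposes_step3 d w A k o : stage w w A -> (w <= d)%N ->
  decomposes d (State Step3 A w k o).
Proof.
move=> [Aw row0 row2_ge0 row2_eq0 tau_ge0 pi_ge0] wd.
have Adw := window_le w d A wd Aw.
have row2 (j : int) : A@_(2, j) = 0.
  by case: j => j; [apply: row2_eq0; rewrite subnn | apply: Aw].
have row1_ge0 (j : nat) : 0 <= A@_(1, j%:Z).
  have [jw|wj] := leqP j w; last by rewrite Aw //; lia.
  by have := tau_ge0 j jw; rewrite (tauE w) // big1 ?addr0.
have A0 : A = sum_terms (row_terms d 1 A).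
  apply/malgP => -[i j]; rewrite sum_row_terms //.
  by case: (ord3_case i) => ->; rewrite ?row0 ?row2 ?mulr0 ?mul1r.
apply: (decomposes_step d _ (row_terms d 1 A)) => //.
  by apply: good_row_terms => j _.
exists 0%N, [::]; split=> //=.
- by rewrite /subtract -/(sum_terms _) -A0 subrr.
- by rewrite cats0.
by rewrite /subtract -/(sum_terms _) -A0 subrr /sum_terms big_nil.
Qed.

Lemma good_Gamma d w k (c : R) : (0 < k < w)%N -> (w <= d)%N -> 0 <= c ->
  good_term d (c, Gamma R (w%:Z - 1 - k%:Z) k).
Proof.
move=> /andP[k0 kw] wd c0.
rewrite (_ : w%:Z - 1 - k%:Z = (w - k.+1)%N%:Z); last by lia.
split=> //=; first by right; exists (w - k.+1)%N%:Z, k.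
by apply: window_le (Gamma_window _ _); lia.
Qed.

(** Induction on w + 1 - k; the hypothesis covers the return to Step 1 with a
    smaller w. *)
Lemma decomposes_step2 d w : (w.+1 <= d)%N ->
  (forall A k o, stage w 0 A -> decomposes d (State Step1 A w k o)) ->
  forall A k o, (0 < k <= w.+1)%N -> stage w.+1 k A ->
  decomposes d (State Step2 A w.+1 k o).
Proof.
move=> wd IHw A k o /andP[k0 kw].
have [e ek] := ubnP (w.+1 - k); elim: e => // e IHe in A k o k0 kw ek *.
move=> inv; have [b0|b_neq0] := eqVneq (A@_(1, w.+1%:Z)) 0.
  apply: decomposes_silent; rewrite /= b0 eqxx //=.
  by apply: IHw; exact: stage_shrink inv k0 b0.
have [k_eq|k_neq] := eqVneq k w.+1.
  apply: decomposes_silent; rewrite /= (negbTE b_neq0) k_eq eqxx //=.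
  by apply: decomposes_step3 => //; rewrite k_eq in inv.
have k_lt : (0 < k < w.+1)%N by lia.
have Gk : w.+1%:Z - 1 - k%:Z = (w.+1 - k.+1)%N%:Z by lia.
pose ts := [:: (mcoef w.+1 k A, Gamma R (w.+1%:Z - 1 - k%:Z) k)].
have stepE : step d (State Step2 A w.+1 k o)
    = State Step2 (subtract ts A) w.+1 k.+1 (o ++ ts).
  by rewrite /= (negbTE b_neq0) (negbTE k_neq).
apply: (decomposes_step d _ ts); rewrite ?stepE //.
  move=> t; rewrite inE => /eqP ->; apply: good_Gamma => //.
  exact: mcoef_ge0 inv k_lt.
rewrite /subtract /ts big_seq1 /= Gk.
set A' := A - _.
have [b'0|b'_neq0] := eqVneq (A'@_(1, w.+1%:Z)) 0.
  apply: decomposes_silent; rewrite /= b'0 eqxx //=.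
  by apply: IHw; apply: stage_shrink k0 b'0; exact: stage_subtract_Gamma.
by apply: IHe => //; [lia | lia | exact: mcoef_tight].
Qed.

Lemma decomposes_step1 d w A k o : (w <= d)%N -> stage w 0 A ->
  decomposes d (State Step1 A w k o).
Proof.
elim: w A k o => [|w IHw] A k o wd inv.
  by apply: decomposes_silent => //=; exact: decomposes_step3.
have Gk : w.+1%:Z - 1 = w%:Z by lia.
apply: (decomposes_step d _
  [:: (A@_(2, w.+1%:Z - 1), E R 2 (w.+1%:Z - 1))]) => //=.
  case: inv => _ _ row2_ge0 _ _ _ t; rewrite inE => /eqP ->.
  by rewrite Gk; apply: good_E => //; lia.
apply: decomposes_step2 => //; first by move=> B k' o'; apply: IHw; lia.
rewrite /subtract big_seq1 /= Gk.
case: inv => Aw row0 row2_ge0 row2_eq0 tau_ge0 pi_ge0.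
apply: (stage_clear w.+1 1 A) => //.
- by apply: windowB => //; apply: window_E; lia.
- by move=> j; rewrite mcoeffB mcoeffZ mcoeff_E row0 mulr0 subr0.
- by move=> j; rewrite mcoeffB mcoeffZ mcoeff_E mulr0 subr0.
- move=> j; rewrite mcoeffB mcoeffZ mcoeff_E /= subSS subn0.
  have [<-|ne] := eqVneq w j; first by rewrite ltnn eqxx mulr1 subrr.
  rewrite (_ : (_ == _) = false) ?mulr0 ?subr0; last by lia.
  by case: ltnP => // wj; apply: row2_eq0; lia.
- by move=> s sw; apply: tau_ge0; lia.
Qed.

Lemma decomposes_init d A : (1 <= d)%N -> cone d A -> decomposes d (init A).
Proof.
move=> d1 [Aw coneA].
have row2_ge0 (j : nat) : 0 <= A@_(2, j%:Z).
  have [jd|dj] := leqP j d; first by apply: (coneA (phi j%:Z)); constructor; lia.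
  by rewrite Aw //; lia.
have row0_ge0 (j : nat) : (j <= d)%N -> 0 <= A@_(0, j%:Z).
  by move=> jd; apply: (coneA (mu j%:Z)); constructor; lia.
pose ts := (A@_(2, d%:Z), E R 2 d%:Z) :: row_terms d 0 A.
have sum_ts : sum_terms ts
    = A@_(2, d%:Z) *: E R 2 d%:Z + sum_terms (row_terms d 0 A).
  by rewrite /sum_terms big_cons.
apply: (decomposes_step d _ ts) => //.
  move=> t; rewrite inE => /predU1P[->|]; last exact: good_row_terms.
  by apply: good_E => //; lia.
apply: decomposes_step1 => //.
rewrite /subtract -/ts -/(sum_terms ts) sum_ts.
set A' := A - _.
have A'E i (j : int) :
    A'@_(i, j)
      = (i != 0)%:R * A@_(i, j) - ((i == 2) && (j == d%:Z))%:R * A@_(2, d%:Z).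
  rewrite /A' mcoeffB mcoeffD mcoeffZ sum_row_terms // mcoeff_E.
  rewrite (eq_sym 2) (eq_sym _ j) (eq_sym 0); case: (i == 0) => /=; ring.
apply: (stage_clear d 0 A) => //.
- move=> i j jd; rewrite A'E Aw // (_ : (j == _) = false) ?andbF; last by lia.
  by rewrite mulr0 mul0r subr0.
- by move=> j; rewrite A'E !mul0r subr0.
- by move=> j; rewrite A'E mul1r mul0r subr0.
- move=> j; rewrite A'E mul1r subn0 /=; case: (ltngtP j d) => [jd|dj|->].
  + by rewrite (_ : (_ == _) = false) ?mul0r ?subr0 //; lia.
  + rewrite (Aw 2); last by lia.
    by rewrite (_ : (_ == _) = false) ?mul0r ?subr0 //; lia.
  + by rewrite eqxx mul1r subrr.
- by move=> s sd; apply: coneA; constructor; lia.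
- move=> n s; rewrite /pi_range => nsd.
  have [n0|n_gt0] := posnP n; first by rewrite n0; apply: coneA; constructor; lia.
  by apply: coneA; apply: HH_pi => //; lia.
Qed.

End Algorithm.

Theorem mainTheorem4 (R : realFieldType) (d : nat) (A : mat R) :
  (1 <= d)%N -> cone d A ->
  exists N : nat,
    let st := run d A N in
    [/\ pc st = Halt,
        cur st = 0,
        (forall t, t \in out st ->
           [/\ 0 <= t.1, DeltaLambda2 t.2 & window d t.2])
      & A = \sum_(t <- out st) t.1 *: t.2].
Proof.
move=> d1 /(decomposes_init _ _ d1) [N [ts [haltN curN outN good_ts A_ts]]].
by exists N; rewrite /run outN; split.
Qed.
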